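(* Let ${}^\bullet\mathbb{R}$ be the ring of Fermat reals and let $<_F$ be the relation on ${}^\bullet\mathbb{R}$ defined, for distinct $x,y\in{}^\bullet\mathbb{R}$, by: $x<_F y$ if and only if at least one of the following holds: (a) there exists $l\in{}^\bullet\mathbb{R}$ such that $x\in\{k\in{}^\bullet\mathbb{R} : k\le l\}$ and $y\notin\{k\in{}^\bullet\mathbb{R} : k\le l\}$; (b) $x=\max\{k\in{}^\bullet\mathbb{R} : k\le l\}$ for some $l\in{}^\bullet\mathbb{R}$, and there exists $h\in{}^\bullet\mathbb{R}$ with $h>0$ and $y=x+h$; (c) $y=\min\{k\in{}^\bullet\mathbb{R} : l\le k\}$ for some $l\in{}^\bullet\mathbb{R}$, and there exists $h\in{}^\bullet\mathbb{R}$ with $h>0$ and $x=y-h$. Then ${}^\bullet\mathbb{R}$ equipped with the order topology from $<_F$ is a LOTS.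
   Context: A little-oh polynomial is a function $x:\mathbb{R}_{\ge0}\to\mathbb{R}$, $t\mapsto x_t=x(t)$, such that $x_t=r+\sum_{i=1}^k\alpha_i t^{a_i}+o(t)$ as $t\to0^+$, for suitable $k\in\mathbb{N}$, $r,\alpha_1,\dots,\alpha_k\in\mathbb{R}$ and $a_1,\dots,a_k\in\mathbb{R}_{\ge0}$. The set of all little-oh polynomials is denoted $\mathbb{R}_o[t]$. For $x,y\in\mathbb{R}_o[t]$, put $x\sim y$ (also written ''$x=y$ in ${}^\bullet\mathbb{R}$'') if and only if $x(t)=y(t)+o(t)$ as $t\to0^+$; this is an equivalence relation. The ring of Fermat reals is ${}^\bullet\mathbb{R}:=\mathbb{R}_o[t]/\!\sim$, with operations induced by the pointwise operations on representatives. The order $\le$ on ${}^\bullet\mathbb{R}$ (Giordano's order) is defined, in terms of representatives (and independently of their choice), by: $x\le y$ if and only if there exists $z$ with $z=0$ in ${}^\bullet\mathbb{R}$ (i.e. $\lim_{t\to0^+}z_t/t=0$) such that for every $t\ge0$ sufficiently small, $x_t\le y_t+z_t$. Here $h>0$ means $0\le h$ and $h\neq0$ in ${}^\bullet\mathbb{R}$; $\max$ and $\min$ are taken with respect to $\le$. A LOTS (linearly ordered topological space) is a topological space whose topology equals the order topology of some linear order on the underlying set. *)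

(* Defs.v *)
From HB Require Import structures.
From mathcomp Require Import all_boot all_order all_algebra.
From mathcomp Require Import generic_quotient ring_quotient.
From mathcomp Require Import ring lra.
From mathcomp Require Import all_classical all_reals all_analysis.

Set Implicit Arguments.
Unset Strict Implicit.
Unset Printing Implicit Defensive.

Import Order.TTheory GRing.Theory Num.Theory.
Import numFieldNormedType.Exports.

Local Open Scope classical_set_scope.
Local Open Scope ring_scope.
Local Open Scope quotient_scope.

Section LittleOh.
Context {R : realType}.
Implicit Types x y z : {nonneg R} -> R.

(* z_t = o(t) as t -> 0+. The absolute value only serves to view the real
   variable t as an element of {nonneg R}: one has t > 0 along 0^'+. *)
Definition little_oh z : Prop :=
  z `|t|%:nng / t @[t --> (0 : R)^'+] --> (0 : R).

Definition little_oh_poly x : Prop :=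
  exists (k : nat) (r : R) (alpha a : 'I_k -> R),
    (forall i, 0 <= a i) /\
    little_oh (fun t => x t - (r + \sum_(i < k) alpha i * t%:num `^ a i)).

Lemma little_oh_eq x y :
  (forall t : {nonneg R}, 0 < t%:num -> x t = y t) ->
  little_oh x -> little_oh y.
Proof.
move=> xy; apply: cvg_trans; apply: near_eq_cvg; near=> t.
rewrite xy//= normr_gt0 gt_eqF//; near: t; exact: nbhs_right_gt.
Unshelve. all: by end_near. Qed.

Lemma little_oh0 : little_oh (fun=> 0).
Proof.
by rewrite /little_oh; under eq_fun do rewrite mul0r; exact: cvg_cst.
Qed.

Lemma little_ohD x y : little_oh x -> little_oh y -> little_oh (x \+ y).
Proof.
move=> ox oy; rewrite /little_oh /=; under eq_fun do rewrite mulrDl.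
have := cvgD ox oy; rewrite addr0; exact.
Qed.

Lemma little_ohN x : little_oh x -> little_oh (\- x).
Proof.
move=> ox; rewrite /little_oh /=; under eq_fun do rewrite mulNr.
have := cvgN ox; rewrite oppr0; exact.
Qed.

Lemma little_ohM x y (l : R) :
  y `|t|%:nng @[t --> (0 : R)^'+] --> l -> little_oh x -> little_oh (x \* y).
Proof.
move=> yl ox; rewrite /little_oh /=; under eq_fun do rewrite mulrAC.
have := cvgM ox yl; rewrite mul0r; exact.
Qed.

Lemma little_oh_cvg x :
  little_oh x -> x `|t|%:nng @[t --> (0 : R)^'+] --> (0 : R).
Proof.
move=> ox.
have t0 : t @[t --> (0 : R)^'+] --> (0 : R) by exact: cvg_within.
have h : x `|t|%:nng / t * t @[t --> (0 : R)^'+] --> (0 * 0 : R) by exact: cvgM.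
rewrite mulr0 in h; apply: cvg_trans h; apply: near_eq_cvg; near=> t => /=.
rewrite divfK// gt_eqF//; near: t; exact: nbhs_right_gt.
Unshelve. all: by end_near. Qed.

Lemma powR_cvg_right (a : R) : 0 <= a ->
  exists l : R, (t `^ a) @[t --> (0 : R)^'+] --> l.
Proof.
rewrite le_eqVlt => /predU1P[<-|a0]; last by exists 0; exact: powR_cvg0.
by exists 1; under eq_fun do rewrite powRr0; exact: cvg_cst.
Qed.

Lemma powsum_cvg (I : Type) (s : seq I) (c a : I -> R) : (forall i, 0 <= a i) ->
  exists l : R, (\sum_(i <- s) c i * (`|t|%:nng : {nonneg R})%:num `^ a i)
              @[t --> (0 : R)^'+] --> l.
Proof.
move=> a0; elim: s => [|i s [l sl]].
  by exists 0; under eq_fun do rewrite big_nil; exact: cvg_cst.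
have [m im] := powR_cvg_right (a0 i).
exists (c i * m + l); under eq_fun do rewrite big_cons.
apply: cvgD => //; apply: cvgMr.
apply: (cvg_trans _ im); apply: near_eq_cvg; near=> t => /=.
rewrite gtr0_norm//; near: t; exact: nbhs_right_gt.
Unshelve. all: by end_near. Qed.

Lemma little_oh_poly_fin (I : finType) (c a : I -> R) x :
  (forall i, 0 <= a i) ->
  little_oh (fun t => x t - \sum_i c i * t%:num `^ a i) -> little_oh_poly x.
Proof.
move=> a0 ox; exists #|I|, 0, (c \o enum_val), (a \o enum_val); split=> //=.
apply: little_oh_eq ox => t _; rewrite add0r; congr (_ - _).
by rewrite (big_enum_val (A := I)).
Qed.

Lemma little_oh_polyP x : little_oh_poly x ->
  exists (I : finType) (c a : I -> R), (forall i, 0 <= a i) /\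
    little_oh (fun t => x t - \sum_i c i * t%:num `^ a i).
Proof.
move=> [k [r [alpha [a [a0 ox]]]]].
exists (option 'I_k), (oapp alpha r), (oapp a 0); split; first by case.
apply: little_oh_eq ox => t _; congr (_ - _).
rewrite [RHS](bigD1 None)//= powRr0 mulr1; congr (_ + _).
rewrite (reindex_omap Some id)/=; last by case.
by apply: eq_bigl => i; rewrite eqxx.
Qed.

Lemma little_oh_poly_cvg x : little_oh_poly x ->
  exists l : R, x `|t|%:nng @[t --> (0 : R)^'+] --> l.
Proof.
move=> /little_oh_polyP[I [c [a [a0 /little_oh_cvg ox]]]].
have [l sl] := powsum_cvg (index_enum I) c a0.
exists (0 + l).
have h := cvgD ox sl; apply: cvg_trans (h _); apply: near_eq_cvg; near=> t.
by rewrite /= subrK.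
Unshelve. all: by end_near. Qed.

Lemma little_oh_poly_oh x : little_oh x -> little_oh_poly x.
Proof.
move=> ox; apply: (@little_oh_poly_fin void (fun=> 0) (fun=> 0)) => //.
by apply: little_oh_eq ox => t _; rewrite big1 ?subr0.
Qed.

Lemma little_oh_poly1 : little_oh_poly (fun=> 1).
Proof.
apply: (@little_oh_poly_fin unit (fun=> 1) (fun=> 0)) => //.
apply: little_oh_eq little_oh0 => t _.
by rewrite (big_pred1 tt)=> [|[]//]; rewrite powRr0 mulr1 subrr.
Qed.

Lemma little_oh_polyB x y :
  little_oh_poly x -> little_oh_poly y -> little_oh_poly (x \- y).
Proof.
move=> /little_oh_polyP[I [c [a [a0 ox]]]] /little_oh_polyP[J [d [b [b0 oy]]]].
apply: (@little_oh_poly_fin (I + J)%type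
  (fun u => match u with inl i => c i | inr j => - d j end)
  (fun u => match u with inl i => a i | inr j => b j end)) => [[]//|].
apply: little_oh_eq (little_ohD ox (little_ohN oy)) => t _ /=.
rewrite big_sumType/=.
have -> : \sum_j - d j * t%:num `^ b j = - \sum_j d j * t%:num `^ b j.
  by rewrite -sumrN; apply: eq_bigr => j _; rewrite mulNr.
ring.
Qed.

Lemma little_oh_polyM x y :
  little_oh_poly x -> little_oh_poly y -> little_oh_poly (x \* y).
Proof.
move=> px py; have [m ym] := little_oh_poly_cvg py.
have /little_oh_polyP[I [c [a [a0 ox]]]] := px.
have /little_oh_polyP[J [d [b [b0 oy]]]] := py.
have [l sl] := powsum_cvg (index_enum I) c a0.
apply: (@little_oh_poly_fin (I * J)%type
  (fun u => c u.1 * d u.2) (fun u => a u.1 + b u.2)) => [[i j]|].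
  exact: addr_ge0.
have o1 := little_ohM ym ox.
have o2 := little_ohM (y := fun t => \sum_i c i * t%:num `^ a i) sl oy.
apply: little_oh_eq (little_ohD o1 o2) => t t0 /=.
have -> : \sum_(u : I * J) c u.1 * d u.2 * t%:num `^ (a u.1 + b u.2) =
    (\sum_i c i * t%:num `^ a i) * (\sum_j d j * t%:num `^ b j).
  rewrite big_distrlr/= pair_big/=; apply: eq_bigr => -[i j] _ /=.
  rewrite powRD; first by rewrite mulrACA.
  by rewrite (gt_eqF t0) implybT.
ring.
Qed.

End LittleOh.

Section Fermat.
Variable R : realType.

Definition little_oh_polys : {pred {nonneg R} -> R} :=
  fun x => `[< little_oh_poly x >].

Lemma little_oh_polys_subring : subring_closed little_oh_polys.
Proof.
split=> [|x y /asboolP px /asboolP py|x y /asboolP px /asboolP py];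
  apply/asboolP.
- exact: little_oh_poly1.
- exact: little_oh_polyB.
- exact: little_oh_polyM.
Qed.

Definition Ro := {x : {nonneg R} -> R | x \in little_oh_polys}.
HB.instance Definition _ := SubChoice.on Ro.
HB.instance Definition _ :=
  GRing.SubChoice_isSubComPzRing.Build ({nonneg R} -> R) little_oh_polys Ro
    little_oh_polys_subring.

Lemma Ro_oner_neq0 : (1 : Ro) != 0.
Proof.
apply/eqP => /(congr1 (fun x : Ro => val x 0%:nng)).
by move/eqP; rewrite rmorph1 rmorph0 oner_eq0.
Qed.
HB.instance Definition _ := GRing.PzSemiRing_isNonZero.Build Ro Ro_oner_neq0.

Definition little_ohs : {pred Ro} := fun x => `[< little_oh (val x) >].

Lemma little_ohs_idealr : idealr_closed little_ohs.
Proof.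
split.
- by apply/asboolP; exact: little_oh0.
- apply/negP => /asboolP /little_oh_cvg o1.
  have c1 : (1 : R) @[_ --> (0 : R)^'+] --> (1 : R) by exact: cvg_cst.
  have /esym/eqP : (0 : R) = 1 by apply: (cvg_unique _ o1 c1).
  by rewrite oner_eq0.
- move=> a u v /asboolP ou /asboolP ov; apply/asboolP.
  have /asboolP/little_oh_poly_cvg[l al] := valP a.
  apply: little_ohD ov; apply: little_oh_eq (little_ohM al ou) => t _ /=.
  by rewrite mulrC.
Qed.
HB.instance Definition _ := isIdealr.Build Ro little_ohs little_ohs_idealr.

Definition fermat := {ideal_quot little_ohs}.
HB.instance Definition _ := GRing.ComNzRing.on fermat.
HB.instance Definition _ := Quotient.on fermat.

Lemma fermat_eqP (x y : Ro) :
  x = y %[mod fermat] <-> little_oh (fun t => val x t - val y t).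
Proof.
split=> [/eqP|xy].
  by rewrite -Quotient.idealrBE => /asboolP.
by apply/eqP; rewrite -Quotient.idealrBE; apply/asboolP.
Qed.

Definition Ro_le (x y : Ro) : Prop :=
  exists z : Ro, z = 0 %[mod fermat] /\
    exists2 d : R, 0 < d &
      forall t : {nonneg R}, t%:num < d -> val x t <= val y t + val z t.

Definition fermat_le (x y : fermat) : Prop := Ro_le (repr x) (repr y).
Definition fermat_gt0 (h : fermat) : Prop := fermat_le 0 h /\ h <> 0.

Lemma fermat_leE (x y : Ro) : fermat_le (\pi x) (\pi y) <-> Ro_le x y.
Proof.
have ind (x1 y1 x2 y2 : Ro) : x1 = x2 %[mod fermat] -> y1 = y2 %[mod fermat] ->
    Ro_le x1 y1 -> Ro_le x2 y2.
  move=> /eqP x12 /eqP y12 [z [/eqP z0 [d d0 xyz]]].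
  exists (z + (x2 - x1) + (y1 - y2)); split.
    apply/eqP; move: x12 y12 z0; rewrite -!Quotient.idealrBE => x12 y12 z0.
    rewrite subr0 in z0; rewrite subr0.
    by apply: rpredD => //; apply: rpredD => //; rewrite -opprB rpredN.
  exists d => // t td; have := xyz t td.
  rewrite !rmorphD !rmorphN/= !fctE; lra.
by split; apply: ind; rewrite reprK.
Qed.

Definition is_max (A : set fermat) (x : fermat) : Prop :=
  A x /\ forall k, A k -> fermat_le k x.
Definition is_min (A : set fermat) (x : fermat) : Prop :=
  A x /\ forall k, A k -> fermat_le x k.

Definition fermat_down (l : fermat) : set fermat := [set k | fermat_le k l].
Definition fermat_up (l : fermat) : set fermat := [set k | fermat_le l k].

Definition ltF (x y : fermat) : Prop := x <> y /\
  [\/ exists l, fermat_down l x /\ ~ fermat_down l y,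
      (exists l, is_max (fermat_down l) x) /\
        (exists h, fermat_gt0 h /\ y = x + h)
    | (exists l, is_min (fermat_up l) y) /\
        (exists h, fermat_gt0 h /\ x = y - h)].

End Fermat.

Definition strict_linear_order (T : Type) (lt : T -> T -> Prop) : Prop :=
  [/\ forall x, ~ lt x x,
      forall x y z, lt x y -> lt y z -> lt x z
    & forall x y, x <> y -> lt x y \/ lt y x].

Definition open_rays (T : Type) (lt : T -> T -> Prop) : set (set T) :=
  [set A | exists a, A = [set x | lt x a] \/ A = [set x | lt a x]].

(* T with the topology generated by the open rays of lt; this is the order
   topology when lt is a strict linear order. *)
Definition ord_space (T : choiceType) (lt : T -> T -> Prop) : Type := T.
HB.instance Definition _ (T : choiceType) (lt : T -> T -> Prop) :=
  Choice.on (ord_space lt).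
HB.instance Definition _ (T : choiceType) (lt : T -> T -> Prop) :=
  isSubBaseTopological.Build (ord_space lt) (open_rays lt) id.

Definition is_LOTS (X : topologicalType) : Prop :=
  exists lt : X -> X -> Prop, strict_linear_order lt /\
    forall A : set X, @open X A <-> @open (ord_space lt) A.

(* Main.v *)
Require Import Defs.
From mathcomp Require Import all_boot all_order all_algebra.
From mathcomp Require Import lra.
From mathcomp Require Import all_classical all_reals all_analysis.

(** On little-oh polynomials the Giordano order is total.  Indeed, modulo
    [o(t)], the difference of two of them is a finite sum of terms
    [c * t `^ a], and such a sum has a constant sign on some interval [(0, d)]:
    it behaves like its term of lowest exponent, once terms with equal
    exponents have been collected and those that cancel have been discarded
    ([powsum_sign]).  Reflexivity and transitivity of [fermat_le] are
    immediate, and antisymmetry is the squeeze theorem, so [fermat_le] is a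
    linear order on the Fermat reals.

    For a linear order, [ltF] is nothing but the strict part of [fermat_le]
    ([ltF_le]): two points [x < y] are separated by the down-set of [x], so
    clause (a) already holds; conversely each of the three clauses forces
    [x <= y], the first one by totality and the other two because adding a
    nonnegative element can only increase.  Hence [ltF] is a strict linear
    order, and the topology generated by its open rays is by construction the
    order topology of that order. *)

Set Implicit Arguments.
Unset Strict Implicit.
Unset Printing Implicit Defensive.

Import Order.TTheory GRing.Theory Num.Theory.
Import numFieldNormedType.Exports.

Local Open Scope classical_set_scope.
Local Open Scope ring_scope.
Local Open Scope quotient_scope.

Section PowerSums.
Context {R : realType}.

(** After division by [t `^ m], where [m] bounds the exponents from below,
    every term of exponent above [m] is a positive power and vanishes at [0],
    while those of exponent [m] are constant. *)
Lemma powsum_div_cvg (I : finType) (P : pred I) (c a : I -> R) (m : R) :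
  (forall i, P i -> m <= a i) ->
  \sum_(i | P i) c i * t `^ (a i - m) @[t --> (0 : R)^'+] -->
  \sum_(i | P i && (a i == m)) c i.
Proof.
move=> ma; rewrite big_mkcondr /=.
apply: cvg_big => [|i Pi]; first exact: add_continuous.
case: eqVneq => [->|am].
  by under eq_fun do rewrite subrr powRr0 mulr1; exact: cvg_cst.
rewrite -[X in _ --> X](mulr0 (c i)); apply: cvgM; first exact: cvg_cst.
by apply: powR_cvg0; rewrite subr_gt0 lt_neqAle eq_sym am ma.
Qed.

(** By induction on the number of terms: if the coefficients of the lowest
    power do not add up to [0], their sum gives the sign near [0]; otherwise
    these terms cancel and fewer remain. *)
Lemma powsum_sign (I : finType) (P : pred I) (c a : I -> R) :
  (\forall t \near (0 : R)^'+, 0 <= \sum_(i | P i) c i * t `^ a i) \/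
  (\forall t \near (0 : R)^'+, \sum_(i | P i) c i * t `^ a i <= 0).
Proof.
have [n] := ubnP #|P|; elim: n P => // n IHn P; rewrite ltnS => Pn.
have [i0 Pi0|P0] := pickP P; last first.
  by left; near=> t; rewrite big_pred0.
case: (Order.TotalTheory.arg_minP a Pi0) => i Pi mi.
have cvgS := powsum_div_cvg (c := c) mi.
set C := \sum_(j | _) c j in cvgS.
have factor t : 0 < t -> \sum_(j | P j) c j * t `^ a j =
    t `^ a i * \sum_(j | P j) c j * t `^ (a j - a i).
  move=> t0; rewrite mulr_sumr; apply: eq_bigr => j _.
  rewrite mulrCA -powRD; first by rewrite [a i + _]addrC subrK.
  by rewrite (gt_eqF t0) implybT.
have [C0|C0|C0] := ltgtP C 0.
- right; near=> t.
  have t0 : 0 < t by near: t; exact: nbhs_right_gt.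
  rewrite factor// pmulr_rle0 ?powR_gt0// ltW//.
  by near: t; exact: (cvgr_lt _ cvgS).
- left; near=> t.
  have t0 : 0 < t by near: t; exact: nbhs_right_gt.
  rewrite factor// pmulr_rge0 ?powR_gt0// ltW//.
  by near: t; exact: (cvgr_gt _ cvgS).
have drop t : \sum_(j | P j) c j * t `^ a j =
    \sum_(j | P j && (a j != a i)) c j * t `^ a j.
  rewrite (bigID (fun j => a j == a i))/=.
  under eq_bigr => j /andP[_ /eqP->] do over.
  by rewrite -mulr_suml -/C C0 mul0r add0r.
case: (IHn (fun j => P j && (a j != a i))) => [|s|s].
- apply: leq_trans Pn; apply: proper_card; apply/properP; split.
    by apply/fintype.subsetP => j /andP[].
  by exists i => //; rewrite unfold_in eqxx andbF.
- by left; near=> t; rewrite drop; near: t.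
- by right; near=> t; rewrite drop; near: t.
Unshelve. all: by end_near. Qed.

End PowerSums.

Section FermatOrder.
Variable R : realType.
Implicit Types x y z : Ro R.
Implicit Types u v w h : fermat R.

(** Trades the bounding Fermat zero for an arbitrary [o(t)] function and the
    explicit interval [[0, d)] for a neighbourhood filter, so that
    inequalities combine by [near] reasoning.  Going back, the inequality at
    [t = 0] is restored by redefining the bound there, which [little_oh] does
    not detect. *)
Lemma Ro_le_near x y : Ro_le x y <->
  exists2 w : {nonneg R} -> R, little_oh w &
    \forall t \near (0 : R)^'+,
      val x `|t|%:nng <= val y `|t|%:nng + w `|t|%:nng.
Proof.
split=> [[z [/fermat_eqP z0 [d d0 xyz]]]|[w ow]].
  exists (val z).
    by apply: little_oh_eq z0 => t _; rewrite rmorph0 subr0.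
  near=> t; apply: xyz => /=; rewrite gtr0_norm.
    by near: t; exact: nbhs_right_lt.
  by near: t; exact: nbhs_right_gt.
rewrite near_withinE => /nbhs_ballP[d /= d0 xyw].
pose z0 (t : {nonneg R}) :=
  if t%:num == 0 then val x t - val y t else w t.
have oz0 : little_oh z0.
  by apply: little_oh_eq ow => t t0; rewrite /z0 gt_eqF.
have pz0 : z0 \in @little_oh_polys R.
  by apply/asboolP; exact: little_oh_poly_oh.
exists (Sub z0 pz0); split.
  by apply/fermat_eqP; apply: little_oh_eq oz0 => t _; rewrite rmorph0 subr0.
exists d => // t td; rewrite SubK /z0.
have [t0|t0] := eqVneq t%:num 0; first by rewrite addrC subrK.
have t_gt0 : 0 < t%:num by rewrite lt_neqAle eq_sym t0 /=.
have normt : `|t%:num|%:nng = t by apply/val_inj; rewrite /= gtr0_norm.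
have := xyw t%:num; rewrite normt; apply=> //.
by rewrite /ball/= sub0r normrN gtr0_norm.
Unshelve. all: by end_near. Qed.

Lemma Ro_le_refl x : Ro_le x x.
Proof.
apply/Ro_le_near; exists (fun=> 0); first exact: little_oh0.
by near=> t; rewrite addr0.
Unshelve. all: by end_near. Qed.

Lemma Ro_le_trans y x z : Ro_le x y -> Ro_le y z -> Ro_le x z.
Proof.
move=> /Ro_le_near[v ov xy] /Ro_le_near[w ow yz]; apply/Ro_le_near.
exists (v \+ w); first exact: little_ohD.
near=> t; rewrite /= [v _ + _]addrC addrA.
apply: (@le_trans _ _ (val y `|t|%:nng + v `|t|%:nng)); first by near: t.
by rewrite lerD2r; near: t.
Unshelve. all: by end_near. Qed.

(** Squeeze: [x - y] lies between two [o(t)] functions. *)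
Lemma Ro_le_anti x y : Ro_le x y -> Ro_le y x -> x = y %[mod fermat R].
Proof.
move=> /Ro_le_near[v ov xy] /Ro_le_near[w ow yx]; apply/fermat_eqP.
apply: (squeeze_cvgr _ (little_ohN ow) ov); near=> t.
have t0 : 0 < t by near: t; exact: nbhs_right_gt.
have xyt : val x `|t|%:nng <= val y `|t|%:nng + v `|t|%:nng by near: t.
have yxt : val y `|t|%:nng <= val x `|t|%:nng + w `|t|%:nng by near: t.
rewrite !ler_pM2r ?invr_gt0//=; move: xyt yxt => /=.
by move=> xyt yxt; apply/andP; split; lra.
Unshelve. all: by end_near. Qed.

Lemma Ro_le_total x y : Ro_le x y \/ Ro_le y x.
Proof.
have /asboolP px := valP x; have /asboolP py := valP y.
have /little_oh_polyP[I [c [a [_ oxy]]]] := little_oh_polyB px py.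
set w := (w in little_oh w) in oxy.
have [s|s] := powsum_sign predT c a; [right|left]; apply/Ro_le_near.
- exists (\- w); first exact: little_ohN.
  near=> t; have t0 : 0 < t by near: t; exact: nbhs_right_gt.
  have : 0 <= \sum_i c i * `|t| `^ a i by rewrite gtr0_norm//; near: t.
  by rewrite /w/=; lra.
- exists w => //.
  near=> t; have t0 : 0 < t by near: t; exact: nbhs_right_gt.
  have : \sum_i c i * `|t| `^ a i <= 0 by rewrite gtr0_norm//; near: t.
  by rewrite /w/=; lra.
Unshelve. all: by end_near. Qed.

Lemma fermat_le_refl u : fermat_le u u.
Proof. exact: Ro_le_refl. Qed.

Lemma fermat_le_trans v u w : fermat_le u v -> fermat_le v w -> fermat_le u w.
Proof. exact: Ro_le_trans. Qed.

Lemma fermat_le_anti u v : fermat_le u v -> fermat_le v u -> u = v.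
Proof. by move=> uv vu; rewrite -[u]reprK -[v]reprK; exact: Ro_le_anti. Qed.

Lemma fermat_le_total u v : fermat_le u v \/ fermat_le v u.
Proof. exact: Ro_le_total. Qed.

Lemma fermat_leDl u h : fermat_le 0 h -> fermat_le u (u + h).
Proof.
elim/quotW: u => x; elim/quotW: h => y.
rewrite -(rmorph0 \pi_(fermat R)) -rmorphD => /fermat_leE/Ro_le_near[w ow yw].
apply/fermat_leE/Ro_le_near; exists w => //; near=> t.
rewrite rmorphD/= -addrA lerDl.
by near: t; move: yw; rewrite rmorph0.
Unshelve. all: by end_near. Qed.

(** A pair [u < v] falls under clause (a) with [l = u], by antisymmetry.
    Conversely, a down-set that contains [u] but not [v] forces [u <= v] by
    totality, and adding [h > 0] preserves the order. *)
Lemma ltF_le u v : ltF u v <-> u <> v /\ fermat_le u v.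
Proof.
split=> -[uv]; last first.
  move=> le_uv; split=> //; apply: Or31; exists u.
  by split=> [|vu]; [exact: fermat_le_refl|exact/uv/fermat_le_anti].
move=> H; split=> //; case: H => [[l [ul vl]]|[_ [h [[h0 _] ->]]]|].
- have [lv|//] := fermat_le_total l v; exact: fermat_le_trans lv.
- exact: fermat_leDl.
- by move=> [_ [h [[h0 _] ->]]]; rewrite -{2}[v](subrK h); exact: fermat_leDl.
Qed.

Lemma ltF_strict_linear_order : strict_linear_order (@ltF R).
Proof.
split=> [u /ltF_le[]//|u v w /ltF_le[uv le_uv] /ltF_le[vw le_vw]|u v uv].
  apply/ltF_le; split; last exact: fermat_le_trans le_vw.
  by move=> uw; apply: uv; apply: fermat_le_anti => //; rewrite uw.
have [le|le] := fermat_le_total u v; [left|right]; apply/ltF_le; split=> //.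
exact/nesym.
Qed.

End FermatOrder.

Theorem theorem14 (R : realType) :
  strict_linear_order (@ltF R) /\ is_LOTS (ord_space (@ltF R)).
Proof.
split; first exact: ltF_strict_linear_order.
by exists (@ltF R); split; first exact: ltF_strict_linear_order.
Qed.
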